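(* Let $M=(S,\mathcal{I})$ be a matroid given by an independence oracle, $S_0\subseteq S$ a set such that some basis of $M$ is not contained in $S_0$, and $w\in\mathbb{Z}^S$. Let $\widehat{\delta}$ be the optimum value of the Relaxed-IM-Not-Exists instance $(M,S_0,w,\|\cdot\|_\infty)$ under integrality constraints, and set $w^*=w+\widehat{\delta}\cdot(\chi_{S\setminus S_0}-\chi_{S_0})$ if this weight function is feasible for IM-Not-Exists, and $w^*=w+(\widehat{\delta}+1)\cdot(\chi_{S\setminus S_0}-\chi_{S_0})$ otherwise. Then $w^*$ is an optimal solution of the IM-Not-Exists instance $(M,S_0,w,\|\cdot\|_\infty)$ and it can be computed in polynomial time.
   Context: IM-Not-Exists: find $w^*\in\mathbb{Z}^S$ such that no basis contained in $S_0$ is a maximum $w^*$-weight basis of $M$ (feasibility), minimizing $\|w-w^*\|_\infty=\max_s|w(s)-w^*(s)|$. Relaxed-IM-Not-Exists under integrality constraints: find $\widehat{w}\in\mathbb{Z}^S$ such that some basis not contained in $S_0$ is a maximum $\widehat{w}$-weight basis, minimizing $\|w-\widehat{w}\|_\infty$. $\chi_Z$ is the characteristic vector of $Z$. Polynomial time is measured in independence oracle calls and elementary operations. *)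

(* Defs.v *)
From HB Require Import structures.
From mathcomp Require Import all_boot all_order all_algebra.

Set Implicit Arguments.
Unset Strict Implicit.
Unset Printing Implicit Defensive.

Import Order.TTheory GRing.Theory Num.Theory.

Local Open Scope ring_scope.

Record matroid (S : finType) := Matroid {
  indep :> pred {set S};
  indep_set0 : indep set0;
  indep_subset : forall X Y : {set S}, X \subset Y -> indep Y -> indep X;
  indep_augment : forall X Y : {set S}, indep X -> indep Y -> (#|X| < #|Y|)%N ->
    exists2 e, e \in Y :\: X & indep (e |: X)
}.

Section InverseMatroid.

Variables (S : finType) (M : matroid S) (S0 : {set S}).
Implicit Types (B Z : {set S}) (u v w : {ffun S -> int}).

Definition basis B : bool := maxset (indep M) B.

Definition weight w B : int := \sum_(s in B) w s.

Definition max_weight_basis w B : bool :=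
  basis B && [forall B', basis B' ==> (weight w B' <= weight w B)].

Definition im_feasible w : bool :=
  [forall B, (basis B && (B \subset S0)) ==> ~~ max_weight_basis w B].

Definition relaxed_feasible w : bool :=
  [exists B, [&& basis B, ~~ (B \subset S0) & max_weight_basis w B]].

Definition linf_norm u : int := \big[Num.max/0]_(s : S) `|u s|.

Definition optimal (feasible : pred {ffun S -> int}) w v : Prop :=
  feasible v /\
  forall u, feasible u -> linf_norm (w - v) <= linf_norm (w - u).

Definition optimum_value (feasible : pred {ffun S -> int}) w (d : int) : Prop :=
  exists2 v, optimal feasible w v & d = linf_norm (w - v).

Definition chi Z : {ffun S -> int} := [ffun s => (s \in Z)%:R].

Definition shifted_weight w (d : int) : {ffun S -> int} :=
  w + (chi (~: S0) - chi S0) *~ d.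

Definition wstar w (d : int) : {ffun S -> int} :=
  if im_feasible (shifted_weight w d) then shifted_weight w d
  else shifted_weight w (d + 1).

End InverseMatroid.

(* Algorithms are programs over integer variables and integer-indexed integer
   arrays, both named by natural numbers. An elementary operation is the
   evaluation of one expression node or the execution of one statement.
   Multiplication is left out on purpose: t operations then lengthen the
   binary encodings of the numbers involved by O(t) bits only, so counting
   each arithmetic operation as one step cannot hide superpolynomial work. *)
Inductive expr :=
| Lit of int
| Var of nat
| Get of nat & expr
| Plus of expr & expr
| Minus of expr & expr
| Half of expr
| Lez of expr & expr
| Eqz of expr & expr.

Inductive cmd :=
| Skip
| Assign of nat & expr
| Store of nat & expr & expr
| Oracle of nat & nat
| Seq of cmd & cmd
| If of expr & cmd & cmd
| While of expr & cmd.

Record state := State { vars : nat -> int; arrays : nat -> int -> int }.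

Definition set_var (st : state) (x : nat) (z : int) : state :=
  State (fun y => if y == x then z else vars st y) (arrays st).

Definition set_cell (st : state) (a : nat) (i z : int) : state :=
  State (vars st)
    (fun b j => if (b == a) && (j == i) then z else arrays st b j).

Fixpoint eval (st : state) (e : expr) : int :=
  match e with
  | Lit z => z
  | Var x => vars st x
  | Get a e1 => arrays st a (eval st e1)
  | Plus e1 e2 => eval st e1 + eval st e2
  | Minus e1 e2 => eval st e1 - eval st e2
  | Half e1 => (eval st e1 %/ 2)%Z
  | Lez e1 e2 => if eval st e1 <= eval st e2 then 1 else 0
  | Eqz e1 e2 => if eval st e1 == eval st e2 then 1 else 0
  end.

Fixpoint expr_cost (e : expr) : nat :=
  match e with
  | Lit _ | Var _ => 1%N
  | Get _ e1 | Half e1 => (expr_cost e1).+1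
  | Plus e1 e2 | Minus e1 e2 | Lez e1 e2 | Eqz e1 e2 =>
      (expr_cost e1 + expr_cost e2)%N.+1
  end.

(* [exec orc c st t st']: started in [st], the program [c] halts in [st'] after
   exactly [t] oracle calls and elementary operations. The oracle is consulted
   on the contents of an array. *)
Inductive exec (orc : (int -> int) -> bool) :
    cmd -> state -> nat -> state -> Prop :=
| exec_Skip st : exec orc Skip st 1%N st
| exec_Assign x e st :
    exec orc (Assign x e) st (expr_cost e).+1 (set_var st x (eval st e))
| exec_Store a ei ez st :
    exec orc (Store a ei ez) st (expr_cost ei + expr_cost ez)%N.+1
      (set_cell st a (eval st ei) (eval st ez))
| exec_Oracle x a st :
    exec orc (Oracle x a) st 1%N (set_var st x (orc (arrays st a))%:R)
| exec_Seq c1 c2 st st1 st2 t1 t2 :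
    exec orc c1 st t1 st1 -> exec orc c2 st1 t2 st2 ->
    exec orc (Seq c1 c2) st (t1 + t2)%N st2
| exec_If e c1 c2 st st1 t :
    exec orc (if eval st e != 0 then c1 else c2) st t st1 ->
    exec orc (If e c1 c2) st (expr_cost e + t)%N.+1 st1
| exec_While_stop e c st :
    eval st e = 0 -> exec orc (While e c) st (expr_cost e).+1 st
| exec_While_step e c st st1 st2 t1 t2 :
    eval st e != 0 -> exec orc c st t1 st1 ->
    exec orc (While e c) st1 t2 st2 ->
    exec orc (While e c) st (expr_cost e + t1 + t2)%N.+1 st2.

Section MatroidInstance.

Variables (S : finType) (M : matroid S) (S0 : {set S}) (w : {ffun S -> int}).

(* Programs see the elements of S as 0, ..., |S|-1, through [enum_rank]. *)
Definition rank_index (s : S) : int := (enum_rank s : nat)%:Z.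

Definition indep_oracle (f : int -> int) : bool :=
  indep M [set s | f (rank_index s) != 0].

Definition encode (u : S -> int) (j : int) : int :=
  \sum_(s : S | rank_index s == j) u s.

(* Variable 0 holds |S|, array 0 holds w and array 1 holds the characteristic
   vector of S_0; everything else is 0. The matroid is not part of the initial
   state: it is accessible through the oracle only. *)
Definition input_state : state :=
  State (fun x => if x == 0%N then #|S|%:Z else 0)
        (fun a => match a with
                  | 0%N => encode w
                  | 1%N => encode (chi S0)
                  | _ => fun=> 0
                  end).

(* The result is read off array 2. *)
Definition outputs (st : state) (v : {ffun S -> int}) : Prop :=
  forall s : S, arrays st 2%N (rank_index s) = v s.

(* Sign and binary digits. *)
Definition bit_size (z : int) : nat := (trunc_log 2 `|z|%N).+2.

Definition instance_size : nat := (#|S| + \sum_(s : S) bit_size (w s))%N.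

Definition computes_within (c : cmd) (v : {ffun S -> int}) (T : nat) : Prop :=
  exists t st, [/\ exec indep_oracle c input_state t st,
                   outputs st v & (t <= T)%N].

End MatroidInstance.

(* Main.v *)
(* Write J for chi_{S \ S0} - chi_{S0}. An exchange argument shows that a
   weight u is feasible for IM-Not-Exists iff some e outside S0 is not spanned
   by {f in S0 : u(f) >= u(e)}, and feasible for the relaxation iff some e
   outside S0 is not spanned by {f in S0 : u(f) > u(e)}. If u lies within
   distance d of w, then w + d J has smaller such sets than u, so it inherits
   either kind of feasibility; and if w + d J is feasible for the relaxation,
   then w + (d + 1) J is feasible for IM-Not-Exists. Hence w* = w + d J for the
   least d >= 0 that makes w + d J feasible, and this w* is optimal.

   For a fixed non-loop e outside S0, the least d such that
   {f in S0 : w(f) >= w(e) + 2d} does not span e is the maximum of 0 and of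
   floor((w(f) - w(e)) / 2) + 1 over the f in S0 such that
   {s in S0 : w(s) >= w(f)} spans e. Spanning is decided by growing a maximal
   independent subset greedily, so O(|S|^3) oracle calls suffice and the sizes
   of the weights play no role. *)

Require Import Defs.
From HB Require Import structures.
From mathcomp Require Import all_boot all_order all_algebra.
From mathcomp Require Import zify.

Set Implicit Arguments.
Unset Strict Implicit.
Unset Printing Implicit Defensive.

Import Order.TTheory GRing.Theory Num.Theory.

Local Open Scope ring_scope.

(** * Feasibility and exchange *)

Section Matroid.

Variables (S : finType) (M : matroid S).
Implicit Types (B I J K T X Y : {set S}) (e f : S) (u v : {ffun S -> int}) (d : int).

(** Repeated augmentation of [X] by elements of [Y], by induction on the difference of the
    cardinalities. *)
Lemma indep_extend X Y : indep M X -> indep M Y -> (#|X| <= #|Y|)%N ->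
  exists J, [/\ X \subset J, J \subset X :|: Y, indep M J & #|J| = #|Y|].
Proof.
elim: {X}(#|Y| - #|X|)%N {-2}X (erefl (#|Y| - #|X|)%N) => [|m IHm] X sizeX iX iY leXY.
  by exists X; split; rewrite ?subsetUl //; lia.
have ltXY : (#|X| < #|Y|)%N by lia.
have [e /setDP[eY eX] ieX] := indep_augment iX iY ltXY.
have cardeX : #|e |: X| = #|X|.+1 by rewrite cardsU1 eX.
have [||J [sXJ sJ iJ cJ]] := IHm (e |: X) _ ieX iY; try lia.
exists J; split=> //; first exact: subset_trans (subsetUr _ _) sXJ.
apply: subset_trans sJ _; rewrite -setUA subUset sub1set inE eY orbT /=.
by rewrite subUset subsetUl subsetUr.
Qed.

Lemma basis_indep B : basis M B -> indep M B.
Proof. by move/maxsetp. Qed.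

Lemma card_indep_basis B X : basis M B -> indep M X -> (#|X| <= #|B|)%N.
Proof.
move=> bB iX; rewrite leqNgt; apply/negP => ltBX.
have [e /setDP[_ eB] ieB] := indep_augment (basis_indep bB) iX ltBX.
have /maxsetP[_ maxB] := bB.
by move: eB; rewrite -(maxB _ ieB (subsetUr _ _)) setU11.
Qed.

Lemma indep_card_basis B X :
  basis M B -> indep M X -> #|X| = #|B| -> basis M X.
Proof.
move=> bB iX cX; apply/maxsetP; split=> // Y iY sXY.
by apply/esym/eqP; rewrite eqEcard sXY cX card_indep_basis.
Qed.

(* For [e \notin T]: [e] lies outside the closure of [T]. *)
Definition unspanned T e : bool :=
  [forall I : {set S}, (I \subset T) && indep M I ==> indep M (e |: I)].

Lemma unspannedP T e :
  reflect (forall I, I \subset T -> indep M I -> indep M (e |: I))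
          (unspanned T e).
Proof.
apply: (iffP forallP) => [h I sI iI | h I].
  by have := h I; rewrite sI iI.
by apply/implyP => /andP[]; apply: h.
Qed.

Lemma unspanned_subset T T' e : T' \subset T -> unspanned T e -> unspanned T' e.
Proof.
move=> sT /unspannedP h; apply/unspannedP => I sI.
by apply: h; apply: subset_trans sT.
Qed.

Lemma unspanned0 e : unspanned set0 e = indep M [set e].
Proof.
apply/unspannedP/idP => [h | ie I]; last by rewrite subset0 => /eqP->; rewrite setU0.
by rewrite -[[set e]]setU0 h ?indep_set0.
Qed.

(** Lets a single oracle call on [e |: K] decide spanning. An independent [I] in [T] extends from
    [e |: K] to size [#|K|.+1]; the extension must contain [e], for otherwise it would lie in [T]
    and be larger than the maximal [K]. *)
Lemma unspanned_max T K e : e \notin T ->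
    K \subset T -> indep M K ->
    (forall x, x \in T -> x \notin K -> ~~ indep M (x |: K)) ->
  unspanned T e = indep M (e |: K).
Proof.
move=> eT sKT iK maxK.
have cardK X : X \subset T -> indep M X -> (#|X| <= #|K|)%N.
  move=> sXT iX; rewrite leqNgt; apply/negP => ltKX.
  have [x /setDP[xX xK]] := indep_augment iK iX ltKX.
  by apply/negP/maxK; rewrite ?(subsetP sXT).
apply/unspannedP/idP => [|ieK I sIT iI]; first exact.
have ceK : #|e |: K| = #|K|.+1 by rewrite cardsU1 (contraNN (subsetP sKT _)).
have [|J [sIJ sJ iJ cJ]] := indep_extend iI ieK.
  by rewrite ceK ltnW // ltnS cardK.
have [eJ | eJ] := boolP (e \in J).
  by apply: indep_subset iJ; rewrite subUset sub1set eJ.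
have /cardK/(_ iJ) : J \subset T; last by rewrite cJ ceK ltnn.
apply/subsetP => x xJ; have := subsetP sJ x xJ; rewrite !inE.
case/or3P => [/(subsetP sIT) // | /eqP xe | /(subsetP sKT) //].
by rewrite xe (negPf eJ) in xJ.
Qed.

(** [e |: (B :&: T)] is independent and extends to a basis inside [e |: B]. The element of [B] that
    this basis misses cannot lie in [T]. *)
Lemma unspanned_exchange B T e : basis M B -> e \notin B -> unspanned T e ->
  exists f, [/\ f \in B, f \notin T & basis M (e |: (B :\ f))].
Proof.
move=> bB eB /unspannedP unsp; have iB := basis_indep bB.
have iBT : indep M (B :&: T) by apply: indep_subset iB; apply: subsetIl.
have ieBT := unsp _ (subsetIr _ _) iBT.
have [|J [sJ Js iJ cJ]] := indep_extend ieBT iB.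
  exact: card_indep_basis ieBT.
have eJ : e \in J by rewrite (subsetP sJ) ?setU11.
have [f fB fJ] : exists2 f, f \in B & f \notin J.
  apply/subsetPn/negP => sBJ.
  have /subset_leq_card : e |: B \subset J by rewrite subUset sub1set eJ.
  by rewrite cJ cardsU1 eB ltnn.
exists f; split=> //.
  by apply: contraNN fJ => fT; rewrite (subsetP sJ) // !inE fB fT orbT.
suff <- : J = e |: (B :\ f) by apply: indep_card_basis cJ.
apply/eqP; rewrite eqEcard cJ cardsU1 !inE negb_and eB orbT add1n.
rewrite (cardsD1 f B) fB leqnn andbT.
apply/subsetP => x xJ; have := subsetP Js x xJ; rewrite !inE.
have -> : x != f by apply: contraNneq fJ => <-.
by case: (x == e); case: (x \in B); rewrite ?andbF.
Qed.

(** An independent [I] in [T] with [e |: I] dependent extends by elements of [B] to a basis [J],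
    which avoids [e]. Augmenting [B :\ e] from [J] then adds an element that can only come from
    [I]. *)
Lemma spanned_exchange B T e :
    basis M B -> e \in B -> ~~ unspanned T e ->
  exists f, [/\ f \in T, f \notin B :\ e & basis M (f |: (B :\ e))].
Proof.
move=> bB eB /forallPn[I]; rewrite negb_imply => /andP[/andP[sIT iI] ieI].
have iB := basis_indep bB.
have cB : #|B| = #|B :\ e|.+1 by rewrite (cardsD1 e B) eB.
have [|J [sIJ sJ iJ cJ]] := indep_extend iI iB; first exact: card_indep_basis iI.
have eJ : e \notin J.
  apply: contraNN ieI => eJ; apply: indep_subset iJ.
  by rewrite subUset sub1set eJ.
have iBe : indep M (B :\ e) by apply: indep_subset iB; apply: subD1set.
have [|f /setDP[fJ fB] ifB] := indep_augment iBe iJ; first by rewrite cJ cB.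
have fe : f != e by apply: contraNneq eJ => <-.
exists f; split=> //.
  have := subsetP sJ f fJ; rewrite inE => /orP[/(subsetP sIT) // | fB'].
  by move: fB; rewrite !inE fe fB'.
by apply: (indep_card_basis bB ifB); rewrite cardsU1 fB cB.
Qed.

Lemma weight_exchange u B e f : f \in B -> e \notin B :\ f ->
  weight u (e |: (B :\ f)) = weight u B - u f + u e.
Proof.
move=> fB eB; rewrite /weight big_setU1 //= [in RHS](big_setD1 f) //=; lia.
Qed.

Lemma max_weight_basisP u B :
  reflect (basis M B /\ forall B', basis M B' -> weight u B' <= weight u B)
          (max_weight_basis M u B).
Proof.
apply: (iffP andP) => -[bB h]; split=> //.
  by move=> B'; apply/implyP/(forallP h).
by apply/forallP => B'; apply/implyP/h.
Qed.

Lemma max_weight_basis_ge u B B' : max_weight_basis M u B -> basis M B' ->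
  weight u B <= weight u B' -> max_weight_basis M u B'.
Proof.
move=> /max_weight_basisP[_ maxB] bB' leBB'.
by apply/max_weight_basisP; split=> // X /maxB; move/le_trans; apply.
Qed.

Lemma max_weight_basis_exists u : exists B, max_weight_basis M u B.
Proof.
have [B0 bB0 _] := maxset_exists (indep_set0 M).
have [B bB maxB] := @arg_maxP _ _ _ B0 (basis M) (weight u) bB0.
by exists B; apply/max_weight_basisP.
Qed.

(** * Feasibility in terms of spanning *)

Variable S0 : {set S}.

(** Left to right, take a maximum-weight basis with fewest elements outside [S0]: if such an element
    [e] were spanned, exchanging it for some [f] in [S0] would keep the weight maximal and lower
    that number. Conversely, bringing an unspanned [e] into a basis inside [S0] strictly increases
    the weight. *)
Lemma im_feasibleE u :
  im_feasible M S0 u =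
  [exists e, (e \notin S0) && unspanned [set f in S0 | u e <= u f] e].
Proof.
apply/idP/existsP => [feas | [e /andP[eS0 unsp]]].
- have [B0 maxB0] := max_weight_basis_exists u.
  have [B maxB minB] :=
    @arg_minP _ _ _ B0 (max_weight_basis M u) (fun B => #|B :\: S0|) maxB0.
  have [bB _] := max_weight_basisP _ _ maxB.
  have /subsetPn[e eB eS0] : ~~ (B \subset S0).
    apply/negP => sB; have /forallP/(_ B) := feas.
    by rewrite bB sB maxB.
  exists e; rewrite eS0; apply/negPn/negP => sp.
  have [f [fT fB bf]] := spanned_exchange bB eB sp.
  move: fT; rewrite inE => /andP[fS0 uef].
  have /minB : max_weight_basis M u (f |: B :\ e).
    by apply: max_weight_basis_ge maxB bf _; rewrite weight_exchange //; lia.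
  have -> : (f |: B :\ e) :\: S0 = (B :\: S0) :\ e.
    apply/setP => x; rewrite !inE; have [->|] := eqVneq x f.
      by rewrite fS0 andbF.
    by rewrite andbCA.
  by rewrite leEnat [X in (X <= _)%N](cardsD1 e) inE eB eS0 ltnn.
- apply/forallP => B; apply/implyP => /andP[bB sB].
  have eB : e \notin B by apply: contraNN eS0 => /(subsetP sB).
  have [f [fB fT bf]] := unspanned_exchange bB eB unsp.
  apply/negP => /max_weight_basisP[_ /(_ _ bf)].
  rewrite weight_exchange ?inE ?negb_and ?eB ?orbT //.
  by move: fT; rewrite inE (subsetP sB) //=; lia.
Qed.

(** The strict inequality shifts the roles: exchanging a spanned [e] away now strictly gains weight,
    while bringing an unspanned [e] in merely loses none. *)
Lemma relaxed_feasibleE u :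
  relaxed_feasible M S0 u =
  [exists e, (e \notin S0) && unspanned [set f in S0 | u e < u f] e].
Proof.
apply/existsP/existsP => [[B /and3P[bB BS0 maxB]] | [e /andP[eS0 unsp]]].
- have /subsetPn[e eB eS0] := BS0.
  exists e; rewrite eS0; apply/negPn/negP => sp.
  have [f [fT fB bf]] := spanned_exchange bB eB sp.
  have [_ /(_ _ bf)] := max_weight_basisP _ _ maxB.
  by move: fT; rewrite weight_exchange // inE => /andP[_]; lia.
- have [B maxB] := max_weight_basis_exists u.
  have [bB _] := max_weight_basisP _ _ maxB.
  have [sB | nsB] := boolP (B \subset S0); last by exists B; rewrite bB nsB maxB.
  have eB : e \notin B by apply: contraNN eS0 => /(subsetP sB).
  have [f [fB fT bf]] := unspanned_exchange bB eB unsp.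
  exists (e |: B :\ f); rewrite bf subUset sub1set (negPf eS0) /=.
  apply: max_weight_basis_ge maxB bf _.
  rewrite weight_exchange ?inE ?negb_and ?eB ?orbT //.
  by move: fT; rewrite inE (subsetP sB) //=; lia.
Qed.

(** * Shifted weights and optimality *)

Lemma shifted_weightE u d e :
  shifted_weight S0 u d e = u e + (if e \in S0 then - d else d).
Proof.
rewrite /shifted_weight !ffunE.
have -> : (fun_of_fin ((chi (~: S0) - chi S0) *~ d)) e
    = (chi (~: S0) e - chi S0 e) *~ d.
  (* An integer multiple is evaluated pointwise separately for each sign of [d]. *)
  case: d => n; rewrite ?NegzE ?mulrNz -?pmulrn;
  by rewrite ?ffunE ?ffunMnE !ffunE.
rewrite !ffunE inE -mulrzr intz; case: (e \in S0) => /=; lia.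
Qed.

(* Restates [ffunE] with [u s] and [v s] at type [int], as [lia] needs. *)
Lemma ffun_subE u v e : (u - v) e = u e - v e.
Proof. by rewrite !ffunE. Qed.

Lemma linf_norm_le u d :
  0 <= d -> reflect (forall e, `|u e| <= d) (linf_norm u <= d).
Proof.
move=> d0; apply: (iffP idP) => [h e | h].
  by apply: le_trans h; rewrite /linf_norm (bigD1 e) //= le_max lexx.
by apply: (big_ind (fun x => x <= d)) => // x y hx hy; rewrite ge_max hx.
Qed.

Lemma linf_norm_ge0 u : 0 <= linf_norm u.
Proof. by apply: (big_ind (fun x => 0 <= x)) => // x y hx hy; rewrite le_max hx. Qed.

Lemma linf_norm_shift u d : 0 <= d -> linf_norm (u - shifted_weight S0 u d) <= d.
Proof.
move=> d0; apply/(linf_norm_le _ d0) => e; rewrite ffun_subE shifted_weightE.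
by case: ifP => _; lia.
Qed.

Lemma im_feasible_shiftE u d :
  im_feasible M S0 (shifted_weight S0 u d) =
  [exists e, (e \notin S0) &&
             unspanned [set f in S0 | u e + d *+ 2 <= u f] e].
Proof.
rewrite im_feasibleE; apply: eq_existsb => e; case: (boolP (e \in S0)) => //= eS0.
congr (unspanned _ e); apply/setP => f; rewrite !inE !shifted_weightE (negPf eS0).
by case: (f \in S0) => //=; lia.
Qed.

Lemma relaxed_feasible_shiftE u d :
  relaxed_feasible M S0 (shifted_weight S0 u d) =
  [exists e, (e \notin S0) &&
             unspanned [set f in S0 | u e + d *+ 2 < u f] e].
Proof.
rewrite relaxed_feasibleE; apply: eq_existsb => e; case: (boolP (e \in S0)) => //= eS0.
congr (unspanned _ e); apply/setP => f; rewrite !inE !shifted_weightE (negPf eS0).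
by case: (f \in S0) => //=; lia.
Qed.

(** Within distance [d] of [u], the difference between an [f] in [S0] and an [e] outside can drop by
    at most [d *+ 2], and the shift attains this for all pairs at once. *)
Lemma im_feasible_shift u v d : 0 <= d -> im_feasible M S0 v ->
  linf_norm (u - v) <= d -> im_feasible M S0 (shifted_weight S0 u d).
Proof.
move=> d0; rewrite im_feasibleE im_feasible_shiftE.
move=> /existsP[e /andP[eS0 unsp]] /(linf_norm_le _ d0) dist.
apply/existsP; exists e; rewrite eS0; apply: unspanned_subset unsp.
apply/subsetP => f; rewrite !inE => /andP[-> /=].
by have := dist e; have := dist f; rewrite !ffun_subE; lia.
Qed.

Lemma relaxed_feasible_shift u v d : 0 <= d -> relaxed_feasible M S0 v ->
  linf_norm (u - v) <= d -> relaxed_feasible M S0 (shifted_weight S0 u d).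
Proof.
move=> d0; rewrite relaxed_feasibleE relaxed_feasible_shiftE.
move=> /existsP[e /andP[eS0 unsp]] /(linf_norm_le _ d0) dist.
apply/existsP; exists e; rewrite eS0; apply: unspanned_subset unsp.
apply/subsetP => f; rewrite !inE => /andP[-> /=].
by have := dist e; have := dist f; rewrite !ffun_subE; lia.
Qed.

Lemma im_feasible_relaxed u : im_feasible M S0 u -> relaxed_feasible M S0 u.
Proof.
rewrite im_feasibleE relaxed_feasibleE => /existsP[e /andP[eS0 unsp]].
apply/existsP; exists e; rewrite eS0; apply: unspanned_subset unsp.
by apply/subsetP => f; rewrite !inE => /andP[-> /ltW].
Qed.

(** One more unit of shift raises the threshold by 2, which turns the strict inequality into a weak
    one. *)
Lemma relaxed_shift_im u d : relaxed_feasible M S0 (shifted_weight S0 u d) ->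
  im_feasible M S0 (shifted_weight S0 u (d + 1)).
Proof.
rewrite relaxed_feasible_shiftE im_feasible_shiftE => /existsP[e /andP[eS0 unsp]].
apply/existsP; exists e; rewrite eS0; apply: unspanned_subset unsp.
by apply/subsetP => f; rewrite !inE => /andP[-> /=]; lia.
Qed.

(** The equality says both that [d] is minimal and that every larger shift stays feasible, so it
    determines [d]. *)
Definition least_shift u d : Prop :=
  0 <= d /\ forall d', 0 <= d' ->
    (d <= d') = im_feasible M S0 (shifted_weight S0 u d').

(** A feasible [v] at distance [r] makes the shift by [r] feasible, whence [d <= r]. *)
Lemma least_shift_optimal u d : least_shift u d ->
  optimal (im_feasible M S0) u (shifted_weight S0 u d).
Proof.
move=> [d0 least]; split=> [|v feas]; first by rewrite -least.
apply: le_trans (linf_norm_shift u d0) _; rewrite least ?linf_norm_ge0 //.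
by apply: im_feasible_shift feas _; rewrite ?linf_norm_ge0.
Qed.

Lemma wstar_least u delta : optimum_value (relaxed_feasible M S0) u delta ->
  exists2 d, least_shift u d & wstar M S0 u delta = shifted_weight S0 u d.
Proof.
move=> [v [feasv minv] deltaE].
have delta0 : 0 <= delta by rewrite deltaE linf_norm_ge0.
have rel : relaxed_feasible M S0 (shifted_weight S0 u delta).
  by apply: relaxed_feasible_shift feasv _; rewrite // deltaE.
(* A feasible shift is also a candidate for the relaxation, at distance at most [d]. *)
have lower d : 0 <= d -> im_feasible M S0 (shifted_weight S0 u d) -> delta <= d.
  move=> d0 /im_feasible_relaxed/minv; rewrite -deltaE => /le_trans; apply.
  exact: linf_norm_shift.
have mono d d' : 0 <= d -> d <= d' ->
    im_feasible M S0 (shifted_weight S0 u d) ->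
    im_feasible M S0 (shifted_weight S0 u d').
  move=> d0 ledd' feas; apply: im_feasible_shift feas _; first exact: le_trans ledd'.
  exact: le_trans (linf_norm_shift u d0) _.
rewrite /wstar; case: ifP => feas; [exists delta | exists (delta + 1)] => //.
- split=> // d' d'0; apply/idP/idP => [led|]; [exact: mono feas | exact: lower].
- split=> [|d' d'0]; first by lia.
  apply/idP/idP => [led | feas'].
    by apply: mono (relaxed_shift_im rel) => //; lia.
  (* Integrality leaves only [delta] itself below [delta + 1], and that shift is infeasible in this
     case. *)
  have := lower _ d'0 feas'; rewrite le_eqVlt => /orP[/eqP deltad | ]; last lia.
  by rewrite deltad feas' in feas.
Qed.

End Matroid.

(** * Bounded loops and their cost *)

(* [PFor x p] runs [p] for [x = 0, ..., n - 1], where [n] is variable 0. *)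
Inductive prog :=
| PSkip
| PAssign of nat & expr
| PStore of nat & expr & expr
| POracle of nat & nat
| PSeq of prog & prog
| PIf of expr & prog & prog
| PFor of nat & prog.

Fixpoint compile (p : prog) : cmd :=
  match p with
  | PSkip => Skip
  | PAssign x e => Assign x e
  | PStore a ei ez => Store a ei ez
  | POracle x a => Oracle x a
  | PSeq p q => Seq (compile p) (compile q)
  | PIf e p q => If e (compile p) (compile q)
  | PFor x p =>
      Seq (Assign x (Lit 0))
          (While (Minus (Var 0) (Var x))
                 (Seq (compile p) (Assign x (Plus (Var x) (Lit 1)))))
  end.

Fixpoint assigns (p : prog) (x : nat) : bool :=
  match p with
  | PSkip | PStore _ _ _ => false
  | PAssign y _ | POracle y _ => x == y
  | PSeq p q | PIf _ p q => assigns p x || assigns q x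
  | PFor y p => (x == y) || assigns p x
  end.

Fixpoint stores (p : prog) (a : nat) : bool :=
  match p with
  | PSkip | PAssign _ _ | POracle _ _ => false
  | PStore b _ _ => a == b
  | PSeq p q | PIf _ p q => stores p a || stores q a
  | PFor _ p => stores p a
  end.

(** A loop body may change neither its counter nor variable 0, so the number of passes is fixed on
    entry. *)
Fixpoint well_formed (p : prog) : bool :=
  match p with
  | PSeq p q | PIf _ p q => well_formed p && well_formed q
  | PFor x p => [&& x != 0%N, ~~ assigns p 0, ~~ assigns p x & well_formed p]
  | _ => true
  end.

(* The constants of [PFor] add up the costs of the initialisation (2), of a
   test of the loop condition (4) and of an increment (4) in [compile]. *)
Fixpoint cost (p : prog) : {poly nat} :=
  match p with
  | PSkip | POracle _ _ => 1%:P
  | PAssign _ e => (expr_cost e).+1%:P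
  | PStore _ ei ez => (expr_cost ei + expr_cost ez)%N.+1%:P
  | PSeq p q => cost p + cost q
  | PIf e p q => (expr_cost e).+1%:P + cost p + cost q
  | PFor _ p => 'X * (cost p + 8%:P) + 6%:P
  end.

(** * Total semantics, loop invariants and running time *)

Section Execution.

Variable orc : (int -> int) -> bool.

Fixpoint run (p : prog) (st : state) : state :=
  match p with
  | PSkip => st
  | PAssign x e => set_var st x (eval st e)
  | PStore a ei ez => set_cell st a (eval st ei) (eval st ez)
  | POracle x a => set_var st x (orc (arrays st a))%:R
  | PSeq p q => run q (run p st)
  | PIf e p q => if eval st e != 0 then run p st else run q st
  | PFor x p =>
      iter `|vars st 0|%N
           (fun s => set_var (run p s) x (vars (run p s) x + 1))
           (set_var st x 0)
  end.

Lemma run_vars p x st : ~~ assigns p x -> vars (run p st) x = vars st x.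
Proof.
elim: p st => [|y e|a ei ez|y a|p IHp q IHq|e p IHp q IHq|y p IHp] st //=.
- by move/negPf->.
- by move/negPf->.
- by rewrite negb_or => /andP[px qx]; rewrite IHq // IHp.
- by rewrite negb_or => /andP[px qx]; case: ifP => _; rewrite ?IHp ?IHq.
- rewrite negb_or => /andP[/negPf xy px].
  by elim: `|_|%N => [|k IHk] /=; rewrite xy // IHp.
Qed.

Lemma run_arrays p a st : ~~ stores p a -> arrays (run p st) a = arrays st a.
Proof.
elim: p st => [|y e|b ei ez|y b|p IHp q IHq|e p IHp q IHq|y p IHp] st //=.
- by move/negPf->.
- by rewrite negb_or => /andP[px qx]; rewrite IHq // IHp.
- by rewrite negb_or => /andP[px qx]; case: ifP => _; rewrite ?IHp ?IHq.
- by move=> pa; elim: `|_|%N => [|k IHk] //=; rewrite IHp.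
Qed.

(** Invariant rule with a built-in frame: whatever the loop never writes keeps its initial value, so
    [Inv] need not record it. *)
Lemma run_for n x p st (Inv : nat -> state -> Prop) :
    well_formed (PFor x p) -> vars st 0%N = n%:Z ->
    Inv 0%N (set_var st x 0) ->
    (forall k s, (k < n)%N -> vars s x = k%:Z ->
       (forall y, ~~ assigns (PFor x p) y -> vars s y = vars st y) ->
       (forall a, ~~ stores p a -> arrays s a = arrays st a) ->
       Inv k s -> Inv k.+1 (set_var (run p s) x k.+1%:Z)) ->
  Inv n (run (PFor x p) st).
Proof.
move=> /and4P[x0 p0 px wfp] st0 Inv0 InvS; rewrite /= st0 absz_nat.
set step := fun s => set_var _ _ _; set s0 := set_var st x 0.
suff /(_ n (leqnn n)) [] : forall k, (k <= n)%N ->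
    [/\ vars (iter k step s0) x = k%:Z,
        forall y, ~~ assigns (PFor x p) y -> vars (iter k step s0) y = vars st y,
        forall a, ~~ stores p a -> arrays (iter k step s0) a = arrays st a
      & Inv k (iter k step s0)] by [].
elim=> [_|k IHk ltkn].
  split=> //= [|y]; first by rewrite eqxx.
  by rewrite negb_or => /andP[/negPf->].
have [xk varsk arrk Invk] := IHk (ltnW ltkn).
have stepE : iter k.+1 step s0 = set_var (run p (iter k step s0)) x k.+1%:Z.
  by rewrite iterS /step run_vars // xk -[k.+1]addn1 PoszD.
rewrite stepE; split=> [|y py|a pa|]; last exact: InvS.
- by rewrite /= eqxx.
- have := py; rewrite /= negb_or => /andP[/negPf-> py'].
  by rewrite run_vars // varsk.
- by rewrite /= run_arrays // arrk.
Qed.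

Lemma exec_compile n p st : well_formed p -> ~~ assigns p 0 ->
    vars st 0%N = n%:Z ->
  exists2 t, exec orc (compile p) st t (run p st) & (t <= (cost p).[n])%N.
Proof.
elim: p st => [|y e|a ei ez|y a|p IHp q IHq|e p IHp q IHq|x p IHp] st /=.
- by move=> _ _ _; exists 1%N; [constructor | rewrite hornerC].
- by move=> _ _ _; eexists; [constructor | rewrite hornerC].
- by move=> _ _ _; eexists; [constructor | rewrite hornerC].
- by move=> _ _ _; exists 1%N; [constructor | rewrite hornerC].
- move=> /andP[wp wq]; rewrite negb_or => /andP[p0 q0] st0.
  have [t1 e1 c1] := IHp st wp p0 st0.
  have [|t2 e2 c2] := IHq (run p st) wq q0; first by rewrite run_vars.
  by exists (t1 + t2)%N; [apply: exec_Seq e1 e2 | rewrite hornerD leq_add].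
- move=> /andP[wp wq]; rewrite negb_or => /andP[p0 q0] st0.
  have [t1 e1 c1] := IHp st wp p0 st0; have [t2 e2 c2] := IHq st wq q0 st0.
  rewrite !hornerD !hornerC; case: ifP => ne0.
  + exists (expr_cost e + t1)%N.+1; last by lia.
    by apply: exec_If; rewrite ne0.
  + exists (expr_cost e + t2)%N.+1; last by lia.
    by apply: exec_If; rewrite ne0.
- move=> /and4P[x0 p0 px wfp]; rewrite negb_or => /andP[_ p0'] st0.
  rewrite st0 absz_nat; set step := fun s => set_var _ _ _; set s0 := set_var st x 0.
  set loop := While _ _.
  (* [m] is the number of passes still to come; the final 4 pays for the failing test. *)
  suff H m : forall s, vars s 0%N = n%:Z -> vars s x + m%:Z = n%:Z ->
      exists2 t, exec orc loop s t (iter m step s)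
               & (t <= m * ((cost p).[n] + 8) + 4)%N.
    have [||t et ct] := H n s0; first by rewrite /= eq_sym (negPf x0).
      by rewrite /= eqxx add0r.
    exists (2 + t)%N.
      by apply: exec_Seq et; apply: (exec_Assign orc x (Lit 0) st).
    rewrite hornerD hornerM hornerX hornerD !hornerC.
    by rewrite -[leqRHS]/(n * ((cost p).[n] + 8) + 6)%N; lia.
  elim: m => [|m IHm] s s0n sx.
    exists 4%N => //; apply: (@exec_While_stop _ (Minus (Var 0) (Var x))) => /=.
    lia.
  have [t1 e1 c1] := IHp s wfp p0' s0n.
  have step0 : vars (step s) 0%N = n%:Z.
    by rewrite /step /= eq_sym (negPf x0) run_vars.
  have [|t2 e2 c2] := IHm (step s) step0.
    by rewrite /step /= eqxx run_vars //; lia.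
  exists (3 + (t1 + 4) + t2)%N.+1; last by lia.
  rewrite iterSr; apply: exec_While_step e2; first by rewrite /= ; lia.
  by apply: exec_Seq e1 _; apply: (exec_Assign orc x (Plus (Var x) (Lit 1))).
Qed.

End Execution.

(** Holds because the coefficients are natural numbers. *)
Lemma horner_nat_monotone (p : {poly nat}) (m n : nat) :
  (m <= n)%N -> (p.[m] <= p.[n])%N.
Proof.
move=> lemn; rewrite !horner_coef.
apply: (big_ind2 (fun x y : nat => (x <= y)%N)) => // [x1 x2 y1 y2|i _].
  exact: leq_add.
apply: leq_mul => //; elim: (i : nat) => [|k IHk]; first by rewrite !expr0.
by rewrite !exprS; apply: leq_mul.
Qed.

(** * Computing the least feasible shift *)

(* Register map: variables 2, 4 and 5 range over [S] (an element e outside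
   [S0], an element f of [S0], and the greedy loop, respectively), 3 is the
   bound for the current e, 1 the minimum of these bounds so far (or -1), and
   6 the last oracle answer. Array 3 holds the set passed to the oracle. *)
Definition clear : prog := PFor 5 (PStore 3 (Var 5) (Lit 0)).

Definition greedy : prog :=
  PFor 5
    (* Two 0/1 values add up to 2 exactly when both conditions hold. *)
    (PIf (Eqz (Plus (Get 1 (Var 5)) (Lez (Get 0 (Var 4)) (Get 0 (Var 5)))) (Lit 2))
       (PSeq (PStore 3 (Var 5) (Lit 1))
          (* Writing the answer back keeps the tentative element if the set is independent and
             removes it otherwise. *)
          (PSeq (POracle 6 3) (PStore 3 (Var 5) (Var 6))))
       PSkip).

Definition query : prog := PSeq (PStore 3 (Var 2) (Lit 1)) (POracle 6 3).

Definition raise_bound : prog :=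
  let bound := Plus (Half (Minus (Get 0 (Var 4)) (Get 0 (Var 2)))) (Lit 1) in
  PSeq (PSeq clear (PSeq greedy query))
    (PIf (Var 6) PSkip (PIf (Lez bound (Var 3)) PSkip (PAssign 3 bound))).

Definition element_bound : prog :=
  PFor 4 (PIf (Get 1 (Var 4)) raise_bound PSkip).

Definition lower_shift : prog :=
  PSeq (PSeq clear query)
    (PIf (Var 6)
       (PSeq (PSeq (PAssign 3 (Lit 0)) element_bound)
          (* A nonzero sum is a disjunction: no bound has been recorded yet, or the new one is no
             larger. *)
          (PIf (Plus (Lez (Var 1) (Lit (-1))) (Lez (Var 3) (Var 1)))
             (PAssign 1 (Var 3)) PSkip))
       PSkip).

Definition compute_shift : prog :=
  PSeq (PAssign 1 (Lit (-1))) (PFor 2 (PIf (Get 1 (Var 2)) PSkip lower_shift)).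

Definition write_shifted : prog :=
  PFor 2 (PIf (Get 1 (Var 2))
            (PStore 2 (Var 2) (Minus (Get 0 (Var 2)) (Var 1)))
            (PStore 2 (Var 2) (Plus (Get 0 (Var 2)) (Var 1)))).

Definition shift_program : prog := PSeq compute_shift write_shifted.

(** * Correctness of the program *)

Section Correctness.

Variables (S : finType) (M : matroid S) (S0 : {set S}) (w : {ffun S -> int}).
Implicit Types (A K T : {set S}) (e f s : S) (d : int) (st : state).

Local Notation run := (run (indep_oracle M)).

Lemma rank_index_inj : injective (@rank_index S).
Proof. by move=> s s' [/val_inj/enum_rank_inj]. Qed.

Lemma encodeE (u : S -> int) s : encode u (rank_index s) = u s.
Proof.
by rewrite /encode (big_pred1 s) // => s'; rewrite (inj_eq rank_index_inj).
Qed.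

Lemma chiE s : chi S0 s = (s \in S0)%:R.
Proof. by rewrite ffunE. Qed.

Definition support (a : int -> int) : {set S} := [set s | a (rank_index s) != 0].

Lemma support_set_cell st a i e z : i = rank_index e ->
  support (arrays (set_cell st a i z) a) =
  if z == 0 then support (arrays st a) :\ e else e |: support (arrays st a).
Proof.
move=> ->; apply/setP => s; rewrite inE /= eqxx /= (inj_eq rank_index_inj).
by case: (boolP (z == 0)) => z0; rewrite !inE; case: (s == e); rewrite ?z0.
Qed.

(** The loop rule with the counter replaced by the set [A] of elements already visited, in the order
    of [enum_rank]. The new counter value is left as an arbitrary [z], so invariants cannot depend
    on it. *)
Lemma run_for_elements x p st (Inv : {set S} -> state -> Prop) :
    well_formed (PFor x p) -> vars st 0%N = #|S|%:Z ->
    Inv set0 (set_var st x 0) ->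
    (forall A e st' z, e \notin A -> vars st' x = rank_index e ->
       (forall y, ~~ assigns (PFor x p) y -> vars st' y = vars st y) ->
       (forall a, ~~ stores p a -> arrays st' a = arrays st a) ->
       Inv A st' -> Inv (e |: A) (set_var (run p st') x z)) ->
  Inv [set: S] (run (PFor x p) st).
Proof.
move=> wfp st0 Inv0 InvS.
pose below k := [set s : S | (enum_rank s < k)%N].
have -> : [set: S] = below #|S| by apply/setP => s; rewrite !inE ltn_ord.
apply: (run_for (Inv := fun k => Inv (below k))) => //.
move=> k st' ltk st'x frameV frameA; pose e := enum_val (Ordinal ltk).
have rank_e : enum_rank e = Ordinal ltk by rewrite enum_valK.
have -> : below k.+1 = e |: below k.
  apply/setP => s; rewrite !inE ltnS leq_eqVlt; congr (_ || _).
  by rewrite -(inj_eq enum_rank_inj) rank_e.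
by apply: InvS => //; rewrite ?inE /rank_index rank_e // ltnn.
Qed.

Definition input_ready st : Prop :=
  [/\ vars st 0%N = #|S|%:Z, arrays st 0%N = encode w
    & arrays st 1%N = encode (chi S0)].

Lemma input_ready_run p st :
    ~~ [|| assigns p 0, stores p 0 | stores p 1] ->
  input_ready st -> input_ready (run p st).
Proof.
rewrite !negb_or => /and3P[p0 a0 a1] [st0 st1 st2].
by split; rewrite ?run_vars ?run_arrays.
Qed.

Lemma run_if_S0 p q st x e :
    arrays st 1 = encode (chi S0) -> vars st x = rank_index e ->
  run (PIf (Get 1 (Var x)) p q) st = if e \in S0 then run p st else run q st.
Proof. by move=> /= -> ->; rewrite encodeE chiE; case: (e \in S0). Qed.

Lemma vars_set_var st x z y : y != x -> vars (set_var st x z) y = vars st y.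
Proof. by move/negPf=> /= ->. Qed.

Lemma run_clear st : vars st 0%N = #|S|%:Z ->
  support (arrays (run clear st) 3) = set0.
Proof.
move=> st0; rewrite -[LHS]setIT.
apply: (run_for_elements (Inv := fun A st => support (arrays st 3) :&: A = set0));
  rewrite ?setI0 // => A e st' z eA st'5 _ _ disj.
rewrite [support _](support_set_cell _ _ _ st'5) eqxx.
apply/setP => s; have /setP/(_ s) := disj; rewrite !inE.
by case: (s == e); rewrite ?andbF.
Qed.

(** The set only grows from pass to pass, so an element once rejected as dependent remains so. *)
Lemma run_greedy st f (T := [set s in S0 | w f <= w s]) :
    input_ready st -> vars st 4%N = rank_index f ->
    support (arrays st 3) = set0 ->
  let K := support (arrays (run greedy st) 3) in
  [/\ K \subset T, indep M K
    & forall s, s \in T -> s \notin K -> ~~ indep M (s |: K)].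
Proof.
move=> [st0 aw aS0] st4 supp0.
pose Inv A st' := let K := support (arrays st' 3) in
  [/\ K \subset T, indep M K
    & forall s, s \in A -> s \in T -> s \notin K -> ~~ indep M (s |: K)].
suff : Inv setT (run greedy st).
  by case=> sK iK maxK; split=> // s; apply: maxK; rewrite inE.
apply: (run_for_elements (Inv := Inv)); rewrite /Inv //=.
  by rewrite supp0 sub0set indep_set0; split=> // s; rewrite inE.
move=> A e st' z eA st'5 frameV frameA [sKT iK maxK].
rewrite (frameA 0%N) // (frameA 1%N) // (frameV 4%N) // aw aS0 st4 st'5 !encodeE.
rewrite chiE.
have -> : ((if (e \in S0)%:R + (if w f <= w e then 1 else 0) == 2 :> int
             then 1 else 0 : int) != 0) = (e \in T).
  by rewrite inE; case: (e \in S0); case: (w f <= w e).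
have [eT | eT] := ifP; last first.
  by split=> // s /setU1P[-> | /maxK//]; rewrite eT.
set b := indep_oracle M _; set st1 := set_cell st' 3 (rank_index e) 1.
have supp1 : support (arrays st1 3) = e |: support (arrays st' 3).
  by rewrite (support_set_cell _ _ _ (erefl _)).
have bE : b = indep M (e |: support (arrays st' 3)) by rewrite -supp1.
rewrite [support _](support_set_cell _ _ _ (erefl _)) supp1.
rewrite /= bE; case: (boolP (indep M (e |: _))) => ieK /=.
  rewrite setUA setUid subUset sub1set eT sKT; split=> // s.
  case/setU1P => [-> | sA] sT; first by rewrite setU11.
  rewrite in_setU1 negb_or => /andP[_ sK].
  apply: contraNN (maxK s sA sT sK); apply: indep_subset.
  by rewrite setUS // subsetUr.
(* Otherwise adding [e] would change nothing and the set would be independent; hence removing [e]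
   restores the former set. *)
have eK : e \notin support (arrays st' 3).
  by apply: contraNN ieK => eK; rewrite (setUidPr _) ?sub1set.
rewrite setU1K //; split=> // s /setU1P[-> // | sA]; exact: maxK.
Qed.

Lemma run_query st e : vars st 2%N = rank_index e ->
  vars (run query st) 6 = (indep M (e |: support (arrays st 3)))%:R.
Proof. by move=> st2; rewrite -[e |: _](support_set_cell st 3 1 st2). Qed.

(** The least integer [d] with [w f < w e + d *+ 2]. *)
Definition threshold e f : int := ((w f - w e) %/ 2)%Z + 1.

Lemma run_raise_bound st e f :
    input_ready st -> vars st 2%N = rank_index e -> vars st 4%N = rank_index f ->
    e \notin S0 ->
  vars (run raise_bound st) 3%N =
  if unspanned M [set s in S0 | w f <= w s] e then vars st 3%N
  else Num.max (vars st 3%N) (threshold e f).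
Proof.
move=> ready st2 st4 eS0; set T := [set s in S0 | _].
set st1 := run clear st; set st2' := run greedy st1.
have ready1 : input_ready st1 by apply: input_ready_run.
have ready2 : input_ready st2' by apply: input_ready_run.
have [sKT iK maxK] : let K := support (arrays st2' 3) in
    [/\ K \subset T, indep M K
      & forall s, s \in T -> s \notin K -> ~~ indep M (s |: K)].
  apply: run_greedy => //; first by rewrite run_vars.
  by apply: run_clear; have [] := ready.
have eT : e \notin T by rewrite inE (negPf eS0).
set st3 := run query st2'.
have [_ aw _] : input_ready st3 by apply: input_ready_run.
have st3V y : y \in [:: 2; 3; 4]%N -> vars st3 y = vars st y.
  by move=> ys; rewrite !run_vars //; case/or4P: ys => // /eqP->.
have st36 : vars st3 6 = (unspanned M T e)%:R.
  rewrite (unspanned_max eT sKT iK maxK) (run_query (e := e)) //.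
  by rewrite !run_vars.
change (run raise_bound st) with (run
  (let bound := Plus (Half (Minus (Get 0 (Var 4)) (Get 0 (Var 2)))) (Lit 1) in
    PIf (Var 6) PSkip (PIf (Lez bound (Var 3)) PSkip (PAssign 3 bound))) st3).
clearbody st3; rewrite /= st36 aw !st3V // st2 st4 !encodeE -/(threshold e f).
case: (unspanned M T e) => /=; first by rewrite st3V.
case: (leP (threshold e f) (vars st 3)) => _ /=; last by [].
by rewrite st3V.
Qed.

(** The computed maximum is described through its upper bounds [d], the form in which it meets
    feasibility of shifts. *)
Lemma run_element_bound st e d :
    input_ready st -> vars st 2 = rank_index e -> e \notin S0 ->
    vars st 3 = 0 ->
  (vars (run element_bound st) 3 <= d) =
  (0 <= d) && [forall f, (f \in S0) &&
    ~~ unspanned M [set s in S0 | w f <= w s] e ==> (threshold e f <= d)].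
Proof.
move=> ready st2 eS0 st3.
pose Inv A st' := (vars st' 3 <= d) =
  (0 <= d) && [forall f, [&& f \in A, f \in S0 &
    ~~ unspanned M [set s in S0 | w f <= w s] e] ==> (threshold e f <= d)].
suff : Inv setT (run element_bound st).
  by move->; congr (_ && _); apply: eq_forallb => f; rewrite inE.
apply: run_for_elements => //; first by have [] := ready.
  rewrite /Inv /= st3; case: (0 <= d) => //=; apply/esym/forallP => f.
  by rewrite inE.
move=> A f st' z fA st'4 frameV frameA; rewrite /Inv => IH.
have ready' : input_ready st'.
  by have [? ? ?] := ready; split; rewrite ?frameV ?frameA.
have st'2 : vars st' 2 = rank_index e by rewrite frameV.
have -> : vars (set_var (run (PIf (Get 1 (Var 4)) raise_bound PSkip) st') 4 z) 3
    = if (f \in S0) && ~~ unspanned M [set s in S0 | w f <= w s] e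
      then Num.max (vars st' 3) (threshold e f) else vars st' 3.
  have [_ _ aS0] := ready'.
  rewrite vars_set_var // (run_if_S0 _ _ aS0 st'4); case: (f \in S0) => //.
  by rewrite (run_raise_bound (e := e) (f := f)) //; case: (unspanned _ _ _).
have -> : forall b : bool,
  ((if b then Num.max (vars st' 3) (threshold e f) else vars st' 3) <= d)
    = (vars st' 3 <= d) && (b ==> (threshold e f <= d)).
  by case; rewrite ?andbT // ge_max.
rewrite IH -andbA; congr (_ && _); apply/andP/forallP => [[/forallP h hf] s | h].
  apply/implyP => /andP[/setU1P[-> | sA] hs]; first by rewrite hs in hf.
  by have := h s; rewrite sA hs.
split; last by have := h f; rewrite setU11.
by apply/forallP => s; apply/implyP => /andP[sA hs]; have := h s; rewrite setU1r ?hs.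
Qed.

(** A threshold exceeds [d] iff [f] meets the bound [w e + d *+ 2], so the upper level set of [f]
    lies in the set on the right. Equality holds for a lightest such [f]; if there is none,
    independence of [[set e]] settles the claim. *)
Lemma thresholdP e d : indep M [set e] -> 0 <= d ->
  [forall f, (f \in S0) &&
    ~~ unspanned M [set s in S0 | w f <= w s] e ==> (threshold e f <= d)] =
  unspanned M [set s in S0 | w e + d *+ 2 <= w s] e.
Proof.
move=> ie d0; rewrite /threshold; apply/forallP/idP => [h | unsp f]; last first.
  apply/implyP => /andP[fS0]; apply: contraNT => ltd; apply: unspanned_subset unsp.
  by apply/subsetP => s; rewrite !inE => /andP[-> /=]; lia.
set D := [set s in S0 | _]; have [D0 | [f0 f0D]] := set_0Vmem D.
  by rewrite D0 unspanned0.
have [f fD minf] : exists2 f, f \in D & forall s, s \in D -> w f <= w s.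
  by have [f] := arg_minP (w : S -> int) f0D; exists f.
apply: contraT => sp; have := h f; move: fD; rewrite inE => /andP[-> lewf] /=.
have -> : ~~ unspanned M [set s in S0 | w f <= w s] e; last by rewrite /=; lia.
apply: contraNN sp; apply: unspanned_subset; apply/subsetP => s sD.
by rewrite inE (minf s sD); move: sD; rewrite inE => /andP[->].
Qed.

Definition reaches d e : bool :=
  (e \notin S0) && unspanned M [set f in S0 | w e + d *+ 2 <= w f] e.

(** The running minimum lies in [[0, d]] iff some visited element reaches [d]; the initial -1 lies
    in no such interval. *)
Lemma run_compute_shift st d : input_ready st -> 0 <= d ->
  (0 <= vars (run compute_shift st) 1 <= d) = [exists e, reaches d e].
Proof.
move=> ready d0; set st1 := set_var st 1 (-1).
have ready1 : input_ready st1 by have [? ? ?] := ready.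
change (run compute_shift st) with
  (run (PFor 2 (PIf (Get 1 (Var 2)) PSkip lower_shift)) st1).
pose Inv A st' :=
  (0 <= vars st' 1 <= d) = [exists e, (e \in A) && reaches d e].
suff -> : Inv setT (run (PFor 2 (PIf (Get 1 (Var 2)) PSkip lower_shift)) st1).
  by apply: eq_existsb => e; rewrite inE.
apply: run_for_elements => //; first by have [] := ready1.
  rewrite /Inv vars_set_var // [vars st1 1]/(-1) [LHS]/=.
  by apply/esym/existsP => -[e]; rewrite inE.
move=> A e st' z eA st'2 frameV frameA; rewrite /Inv => IH.
have ready' : input_ready st'.
  by have [? ? ?] := ready1; split; rewrite ?frameV ?frameA.
have [_ _ aS0] := ready'.
have -> : [exists s, (s \in e |: A) && reaches d s] =
    (0 <= vars st' 1 <= d) || reaches d e.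
  rewrite IH; apply/existsP/orP => [[s /andP[/setU1P[->|sA] hs]] | []].
  - by right.
  - by left; apply/existsP; exists s; rewrite sA.
  - by move=> /existsP[s /andP[sA hs]]; exists s; rewrite setU1r.
  - by exists e; rewrite setU11.
rewrite vars_set_var // (run_if_S0 _ _ aS0 st'2) /reaches.
case: (boolP (e \in S0)) => [_ | eS0]; first by rewrite orbF.
set st2 := run (PSeq clear query) st'.
have ready2 : input_ready st2 by apply: input_ready_run.
have st26 : vars st2 6 = (indep M [set e])%:R.
  rewrite -[[set e]]setU0 -(run_clear (st := st')); last by have [] := ready'.
  by rewrite -run_query // run_vars.
have st21 : vars st2 1 = vars st' 1 by rewrite run_vars.
have st22 : vars st2 2 = rank_index e by rewrite run_vars.
set st3 := run (PSeq (PAssign 3 (Lit 0)) element_bound) st2.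
have st31 : vars st3 1 = vars st' 1 by rewrite run_vars.
have -> : vars (run lower_shift st') 1 =
  if indep M [set e] then
    if (vars st' 1 <= -1) || (vars st3 3 <= vars st' 1) then vars st3 3
    else vars st' 1
  else vars st' 1.
  transitivity (vars (if vars st2 6 != 0 then
    if ((if vars st3 1 <= -1 then 1 else 0) +
        (if vars st3 3 <= vars st3 1 then 1 else 0) : int) != 0
    then set_var st3 1 (vars st3 3) else st3 else st2) 1); first by [].
  rewrite st26 st31; case: (indep M _) => //=.
  by case: (vars st' 1 <= -1); case: (vars st3 3 <= vars st' 1).
case: (boolP (indep M [set e])) => [ie | ie]; last first.
  (* A loop is spanned by every set, as the empty set witnesses. *)
  rewrite orbC; case: unspannedP => // /(_ set0 (sub0set _) (indep_set0 _)).
  by rewrite setU0 (negPf ie).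
have ready3 : input_ready (set_var st2 3 0) by have [? ? ?] := ready2.
have bnd d' : (vars st3 3 <= d') = _ :=
  run_element_bound d' ready3 st22 eS0 (erefl _).
have := bnd d; rewrite d0 /= thresholdP // => <-.
have : 0 <= vars st3 3 by have := bnd (vars st3 3); rewrite lexx => /esym/andP[].
by case: ifP; lia.
Qed.

Lemma run_write_shifted st : input_ready st ->
  outputs (run write_shifted st) (shifted_weight S0 w (vars st 1)).
Proof.
move=> ready.
pose Inv A st' := forall s, s \in A ->
  arrays st' 2 (rank_index s) = shifted_weight S0 w (vars st 1) s.
suff : Inv setT (run write_shifted st) by move=> h s; apply: h; rewrite inE.
apply: run_for_elements => //; first by have [] := ready.
  by move=> s; rewrite inE.
move=> A e st' z eA st'2 frameV frameA IH s.
have [_ aw aS0] := ready.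
have -> : arrays (set_var (run (PIf (Get 1 (Var 2))
    (PStore 2 (Var 2) (Minus (Get 0 (Var 2)) (Var 1)))
    (PStore 2 (Var 2) (Plus (Get 0 (Var 2)) (Var 1)))) st') 2 z) 2 (rank_index s) =
  if s == e then shifted_weight S0 w (vars st 1) e
  else arrays st' 2 (rank_index s).
  rewrite [LHS]/(arrays (run _ _) 2 _) (run_if_S0 _ _ _ st'2) ?(frameA 1) //.
  rewrite shifted_weightE; case: (e \in S0);
  by rewrite /= st'2 (frameA 0) // aw encodeE frameV // (inj_eq rank_index_inj).
by case: eqP => [-> // | se] /setU1P[/se // | /IH].
Qed.

Lemma shift_program_outputs d : least_shift M S0 w d ->
  outputs (run shift_program (input_state S0 w)) (shifted_weight S0 w d).
Proof.
move=> [d0 least]; set st := run compute_shift (input_state S0 w).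
have ready0 : input_ready (input_state S0 w) by [].
have ready : input_ready st by apply: input_ready_run.
suff <- : vars st 1 = d by apply: run_write_shifted.
have least' d' : 0 <= d' -> (0 <= vars st 1 <= d') = (d <= d').
  by move=> d'0; rewrite run_compute_shift // least // im_feasible_shiftE.
(* The equivalence at [d] bounds the computed value from above; at the value itself it gives the
   reverse inequality. *)
have := least' d d0; rewrite lexx => /andP[st10 st1d].
by have := least' _ st10; rewrite st10 lexx; lia.
Qed.

End Correctness.

Theorem theorem6p6 :
  (forall (S : finType) (M : matroid S) (S0 : {set S}) (w : {ffun S -> int})
          (delta : int),
      (exists B : {set S}, basis M B /\ ~~ (B \subset S0)) ->
      optimum_value (relaxed_feasible M S0) w delta ->
      optimal (im_feasible M S0) w (wstar M S0 w delta))
  /\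
  (exists (c : cmd) (p : {poly nat}),
    forall (S : finType) (M : matroid S) (S0 : {set S}) (w : {ffun S -> int})
           (delta : int),
      (exists B : {set S}, basis M B /\ ~~ (B \subset S0)) ->
      optimum_value (relaxed_feasible M S0) w delta ->
      computes_within M S0 w c (wstar M S0 w delta) p.[instance_size w]).
Proof.
split=> [S M S0 w delta _ /wstar_least[d least ->] |].
  exact: least_shift_optimal.
exists (compile shift_program), (cost shift_program).
move=> S M S0 w delta _ /wstar_least[d least ->].
have [//|//|//|t e ct] := @exec_compile (indep_oracle M) #|S| shift_program
  (input_state S0 w).
exists t, (run (indep_oracle M) shift_program (input_state S0 w)).
split=> //; first exact: shift_program_outputs.
(* The cost is a polynomial in [#|S|], which is at most the instance size. *)
by apply: leq_trans ct (horner_nat_monotone _ _); apply: leq_addr.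
Qed.
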